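(* Let $u>0$, $\rho\ge0$, $\lambda>0$, let $\{X_i\}_{i\ge1}$ be iid random variables with finite mean $\mu>0$, and let $$R^{\alpha_1,\alpha_2}(t)=u+\mu(1+\rho)\lambda Y_{\alpha_1,\alpha_2}(t)-\sum_{i=1}^{N^{\alpha_1,\alpha_2}(t)}X_i,\quad t\ge0,$$ be the mixed fractional risk process. Then for $0\le s\le t$, $$\operatorname{Cov}\left(R^{\alpha_1,\alpha_2}(s),R^{\alpha_1,\alpha_2}(t)\right)=\mu^2\lambda^2\rho^2\operatorname{Cov}\left(Y_{\alpha_1,\alpha_2}(s),Y_{\alpha_1,\alpha_2}(t)\right)+\mathbb{E}(X_1^2)\,\mathbb{E}\left(N^{\alpha_1,\alpha_2}(s)\right),$$ and hence $$\operatorname{Var}\left(R^{\alpha_1,\alpha_2}(t)\right)=\mu^2\lambda^2\rho^2\operatorname{Var}\left(Y_{\alpha_1,\alpha_2}(t)\right)+\mathbb{E}(X_1^2)\,\mathbb{E}\left(N^{\alpha_1,\alpha_2}(t)\right).$$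
   Context: Fix $0<\alpha_2<\alpha_1<1$ and $C_1,C_2\ge0$ with $C_1+C_2=1$. The mixed stable subordinator $\{D_{\alpha_1,\alpha_2}(t)\}_{t\ge0}$ is the subordinator (non-decreasing L\'evy process) with $\mathbb{E}(e^{-sD_{\alpha_1,\alpha_2}(t)})=e^{-t(C_1s^{\alpha_1}+C_2s^{\alpha_2})}$, $s\ge0$. Its inverse is $Y_{\alpha_1,\alpha_2}(t)=\inf\{s\ge0:D_{\alpha_1,\alpha_2}(s)>t\}$. The mixed fractional Poisson process (MFPP) is $N^{\alpha_1,\alpha_2}(t)=N(Y_{\alpha_1,\alpha_2}(t))$, where $\{N(t)\}_{t\ge0}$ is a homogeneous Poisson process with intensity $\lambda$ independent of $\{Y_{\alpha_1,\alpha_2}(t)\}_{t\ge0}$. The MFPP is assumed to be independent of the sequence $\{X_i\}_{i\ge1}$.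
   Formalization: The claims {X_i} are assumed independent of the pair of processes (Y, N(Y)) jointly, not only of the MFPP N(Y); with independence from N(Y) alone the formula fails, since X_1 may be correlated with Y given N(Y). *)

(* Defs.v *)
From HB Require Import structures.
From mathcomp Require Export all_boot all_order all_algebra.
From mathcomp Require Export all_classical all_reals all_analysis.
Export Order.TTheory GRing.Theory Num.Theory.
Export numFieldTopology.Exports numFieldNormedType.Exports.

Set Implicit Arguments.
Unset Strict Implicit.
Unset Printing Implicit Defensive.

Local Open Scope classical_set_scope.
Local Open Scope ring_scope.

(* Stochastic processes in continuous time are indexed by R, but only the times
   t >= 0 are ever constrained or used. *)

Section independence.
Context {d : measure_display} {T : measurableType d} {R : realType}.
Variable P : probability T R.

Definition independent_family {I : choiceType} {d' : measure_display}
    {U : measurableType d'} (Z : I -> T -> U) : Prop :=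
  forall (s : seq I), uniq s ->
  forall B : I -> set U, (forall i, measurable (B i)) ->
    P (\bigcap_(i in [set` s]) (Z i @^-1` B i))
    = (\prod_(i <- s) P (Z i @^-1` B i))%E.

Definition same_law {d' : measure_display} {U : measurableType d'}
    (X Y : T -> U) : Prop :=
  forall B : set U, measurable B -> P (X @^-1` B) = P (Y @^-1` B).

Definition process_sigma {I : Type} {d' : measure_display}
    {U : measurableType d'} (times : set I) (Z : I -> T -> U) : set (set T) :=
  <<s \bigcup_(i in times) g_sigma_algebra_preimage (Z i) >>.

Definition independent_sigma (F G : set (set T)) : Prop :=
  forall A B : set T, F A -> G B -> P (A `&` B) = (P A * P B)%E.

End independence.

Section processes.
Context {d : measure_display} {T : measurableType d} {R : realType}.
Variable P : probability T R.

Definition cadlag (f : R -> R) : Prop :=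
  forall t : R, 0 <= t ->
    f x @[x --> t^'+] --> f t /\ (0 < t -> cvg (f x @[x --> t^'-])).

Definition independent_increments (Z : R -> T -> R) : Prop :=
  forall t : nat -> R, 0 <= t 0%N -> (forall i, t i <= t i.+1) ->
    independent_family P (fun i w => Z (t i.+1) w - Z (t i) w).

Definition stationary_increments (Z : R -> T -> R) : Prop :=
  forall s h : R, 0 <= s -> 0 <= h ->
    same_law P (fun w => Z (s + h) w - Z s w) (fun w => Z h w - Z 0 w).

(* Stochastic continuity, often listed among the axioms, follows from
   stationarity of the increments and right-continuity at 0. *)
Definition levy_process (Z : R -> {RV P >-> R}) : Prop :=
  [/\ P [set w | Z 0 w = 0] = 1%E,
      independent_increments (fun t => Z t),
      stationary_increments (fun t => Z t)
    & forall w, cadlag (fun t => Z t w)].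

Definition subordinator (Z : R -> {RV P >-> R}) : Prop :=
  levy_process Z /\
  forall w (s t : R), 0 <= s -> s <= t -> Z s w <= Z t w.

Definition mixed_stable_subordinator (alpha1 alpha2 C1 C2 : R)
    (D : R -> {RV P >-> R}) : Prop :=
  subordinator D /\
  forall s t : R, 0 <= s -> 0 <= t ->
    'E_P[fun w => (expR (- (s * D t w)))%R]%E
    = (expR (- (t * (C1 * s `^ alpha1 + C2 * s `^ alpha2))))%:E.

(* The truncated subtraction in the law of the increments is exact, the paths
   being nondecreasing; s = t is left out because the library's poisson_pmf is
   not a probability mass function at rate 0. *)
Definition poisson_process (lambda : R) (N : R -> {RV P >-> nat}) : Prop :=
  [/\ P [set w | N 0 w = 0%N] = 1%E,
      independent_increments (fun t w => (N t w)%:R),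
      forall s t : R, 0 <= s -> s < t -> forall k : nat,
        P [set w | (N t w - N s w)%N = k]
        = (poisson_pmf (lambda * (t - s)) k)%:E,
      forall w (s t : R), 0 <= s -> s <= t -> (N s w <= N t w)%N
    & forall w, cadlag (fun t => (N t w)%:R)].

(* If the path of D never exceeds t, the infimum is over the empty set and the
   library sets it to 0 instead of +oo; for the mixed stable subordinator this
   is an event of probability 0. *)
Definition inverse_process (D : R -> T -> R) (t : R) (w : T) : R :=
  inf [set x : R | 0 <= x /\ t < D x w].

Definition mfpp (D : R -> T -> R) (N : R -> T -> nat) (t : R) (w : T) : nat :=
  N (inverse_process D t w) w.

(* The claim sequence is indexed from 0: X i stands for X_{i+1}. *)
Definition mixed_fractional_risk (u mu rho lambda : R) (D : R -> T -> R)
    (N : R -> T -> nat) (X : nat -> T -> R) (t : R) (w : T) : R :=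
  u + mu * (1 + rho) * lambda * inverse_process D t w
  - \sum_(i < mfpp D N t w) X i w.

(* Joint independence of the claims from the pair (Y, N(Y)): the risk process
   involves Y itself, which is not a function of the path of N(Y), so that
   independence of the claims from N(Y) alone would leave the covariances of Y
   with the claims undetermined. *)
Definition claims_independent_of_mfpp (D : R -> T -> R) (N : R -> T -> nat)
    (X : nat -> T -> R) : Prop :=
  independent_sigma P (process_sigma setT X)
    (process_sigma [set t : R | 0 <= t]
       (fun t w => (inverse_process D t w, mfpp D N t w))).

End processes.

(* Main.v *)
From HB Require Import structures.
Require Import Defs.
From mathcomp Require Import ring lra measurable_realfun.

(* Conditionally on (Y, N(Y)) the risk process has mean u + beta Y(t) -
   mu (N(Y(t)) - lambda Y(t)), with beta = mu lambda rho, and conditionally on Y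
   the compensated term N(Y(t)) - lambda Y(t) is centered, with covariance
   lambda Y(s). The first level of randomness contributes
   beta^2 Cov(Y(s), Y(t)) + mu^2 E N(Y(s)). At the second level, the product of
   the centered claim sums up to N(Y(s)) and N(Y(t)) is a sum of squares, with
   mean Var(X_1) E N(Y(s)), plus off-diagonal terms of mean zero.
   As E(X_1^2) may be infinite, only the nonnegative sum of squares is allowed to
   have an infinite integral: all the rest is shown integrable, using that Y(t)
   has a finite second moment. Conditioning is implemented by decoupling: for
   independent f1 and f2, the integral of h(f1 w, f2 w) is the double integral of
   h(f1 w1, f2 w2). *)

Set Implicit Arguments.
Unset Strict Implicit.
Unset Printing Implicit Defensive.

Local Open Scope classical_set_scope.
Local Open Scope ring_scope.

(** * Decoupling of independent maps through the product of their laws *)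

Section decoupling.
Context {d d1 d2 : measure_display} {T : measurableType d}
  {T1 : measurableType d1} {T2 : measurableType d2} {R : realType}.
Variable P : probability T R.
Variables (f1 : T -> T1) (f2 : T -> T2).
Hypotheses (mf1 : measurable_fun setT f1) (mf2 : measurable_fun setT f2).
Hypothesis f12 : forall A B, measurable A -> measurable B ->
  P (f1 @^-1` A `&` f2 @^-1` B) = (P (f1 @^-1` A) * P (f2 @^-1` B))%E.

Let g1 : {mfun T >-> T1} := HB.pack f1 (isMeasurableFun.Build _ _ _ _ f1 mf1).
Let g2 : {mfun T >-> T2} := HB.pack f2 (isMeasurableFun.Build _ _ _ _ f2 mf2).
Let f12m : measurable_fun setT (fun w => (f1 w, f2 w)).
Proof. exact: measurable_fun_pair. Qed.
Let g12 : {mfun T >-> (T1 * T2)%type} :=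
  HB.pack (fun w => (f1 w, f2 w)) (isMeasurableFun.Build _ _ _ _ _ f12m).

(** By [f12] the two measures agree on measurable rectangles, which characterizes the product
    measure. *)
Let joint_law A : measurable A ->
  distribution P g12 A = (distribution P g1 \x distribution P g2)%E A.
Proof.
move=> mA; apply/esym.
apply: (@product_measure_unique _ _ _ _ _ (distribution P g1) (distribution P g2)
  (distribution P g12)) => //.
Qed.

Let mpair2 (h : T1 * T2 -> \bar R) (y : T2) : measurable_fun setT h ->
  measurable_fun setT (fun x => h (x, y)).
Proof. exact: measurable_fun_pair1. Qed.

(** Transport to the laws, apply Tonelli, transport back. No finiteness enters, so it serves both to
    prove integrability, through absolute values, and to compute integrals that may be infinite. *)
Lemma decouple_ge0 (h : T1 * T2 -> \bar R) : measurable_fun setT h ->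
  (forall z, 0 <= h z)%E ->
  (\int[P]_w h (f1 w, f2 w) = \int[P]_w2 \int[P]_w1 h (f1 w1, f2 w2))%E.
Proof.
move=> mh h0.
transitivity (\int[distribution P g12]_z h z)%E.
  by rewrite ge0_integral_distribution.
transitivity (\int[distribution P g1 \x distribution P g2]_z h z)%E.
  by apply: eq_measure_integral => A mA _; exact: joint_law.
rewrite fubini_tonelli2// /fubini_G ge0_integral_distribution//; last 2 first.
- exact: (measurable_fun_fubini_tonelli_G h).
- by move=> y; exact: integral_ge0.
apply: eq_integral => w2 _ /=.
by rewrite ge0_integral_distribution//; exact: mpair2.
Qed.

Lemma measurable_decoupled_ge0 (h : T1 * T2 -> \bar R) : measurable_fun setT h ->
  (forall z, 0 <= h z)%E ->
  measurable_fun setT (fun w2 => \int[P]_w1 h (f1 w1, f2 w2))%E.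
Proof.
move=> mh h0.
apply: (eq_measurable_fun ((fun y => \int[distribution P g1]_x h (x, y)) \o f2)%E).
  by move=> w _ /=; rewrite ge0_integral_distribution//; exact: mpair2.
apply: measurableT_comp => //; exact: (measurable_fun_fubini_tonelli_G h).
Qed.

(** The Fubini counterpart for signed [h]. The inner integral is prescribed only almost everywhere,
    because the orderings of the inverse process and of the claim count at two times, on which its
    value will depend, are only almost sure. *)
Lemma decouple_integrable (h : T1 * T2 -> \bar R) (g : T -> \bar R) :
  measurable_fun setT h ->
  P.-integrable setT (fun w => h (f1 w, f2 w)) ->
  measurable_fun setT g ->
  {ae P, forall w2, P.-integrable setT (fun w1 => h (f1 w1, f2 w2)) /\
     (\int[P]_w1 h (f1 w1, f2 w2) = g w2)%E} ->
  (\int[P]_w h (f1 w, f2 w) = \int[P]_w2 g w2)%E.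
Proof.
move=> mh ih mg aeg.
have ih12 : (distribution P g12).-integrable setT h.
  by apply: integrable_pushforward => //; exact: f12m.
have ih1x2 : (distribution P g1 \x distribution P g2)%E.-integrable setT h.
  apply/integrableP; split => //; move/integrableP : ih12 => [_]; apply: le_lt_trans.
  rewrite le_eqVlt; apply/orP; left; apply/eqP.
  by apply: eq_measure_integral => A mA _; apply/esym; exact: joint_law.
transitivity (\int[distribution P g12]_z h z)%E.
  by rewrite integral_distribution.
transitivity (\int[distribution P g1 \x distribution P g2]_z h z)%E.
  by apply: eq_measure_integral => A mA _; exact: joint_law.
rewrite -integral21_prod_meas1// integral_distribution//; last 2 first.
- exact: (measurable_fubini_G ih1x2).
(* The inner integral of [h] is integrable: its absolute value is at most the inner integral of
   [|h|], whose outer integral is finite. *)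
- have mG := measurable_fubini_G ih1x2.
  apply/integrableP; split; first exact: measurableT_comp.
  rewrite -(@ge0_integral_distribution _ _ _ _ _ P g2 (abse \o fubini_G (distribution P g1) h))//; last 2 first.
  - exact: measurableT_comp.
  - by move=> y /=.
  move/(integrable21ltyP _ _ mh) : (ih1x2); apply: le_lt_trans.
  apply: ge0_le_integral => //; [by move=> y /= _|exact: measurableT_comp| |].
    apply: (measurable_fun_fubini_tonelli_G (abse \o h)) => //.
      exact: measurableT_comp.
    by move=> y /=.
  by move=> y _; apply: le_abse_integral => //; exact: mpair2.
apply: ae_eq_integral => //.
  by apply: measurableT_comp => //; exact: (measurable_fubini_G ih1x2).
apply: filterS aeg => w2 [iw2 hg] _ /=.
by rewrite /fubini_G integral_distribution//; exact: mpair2.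
Qed.

End decoupling.

(* Integrating (f + g)^+ + f^- = (f + g)^- + f^+ + g avoids any case analysis
   on the finiteness of the integral of g. *)
Lemma integralD_ge0r {d : measure_display} {T : measurableType d} {R : realType}
    (mu : {measure set T -> \bar R}) (f g : T -> R) :
  mu.-integrable setT (EFin \o f) -> measurable_fun setT g ->
  (forall w, 0 <= g w) ->
  (\int[mu]_w (f w + g w)%:E = \int[mu]_w (f w)%:E + \int[mu]_w (g w)%:E)%E.
Proof.
move=> intf mg g0.
have mf : measurable_fun setT f by apply/measurable_EFinP; exact: measurable_int intf.
have mfg : measurable_fun setT (f \+ g) by exact: measurable_funD.
pose fp w := Num.max (f w) 0; pose fn w := Num.max (- f w) 0.
pose hp w := Num.max (f w + g w) 0; pose hn w := Num.max (- (f w + g w)) 0.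
have mfp : measurable_fun setT (EFin \o fp).
  by apply/measurable_EFinP; exact: measurable_maxr.
have mfn : measurable_fun setT (EFin \o fn).
  by apply/measurable_EFinP; apply: measurable_maxr => //; exact: measurableT_comp.
have mhp : measurable_fun setT (EFin \o hp).
  by apply/measurable_EFinP; exact: measurable_maxr.
have mhn : measurable_fun setT (EFin \o hn).
  by apply/measurable_EFinP; apply: measurable_maxr => //; apply: measurableT_comp.
have mge : measurable_fun setT (EFin \o g) by exact/measurable_EFinP.
have max0 (x : R) : 0 <= Num.max x 0 by rewrite le_max lexx orbT.
have fp0 w : 0 <= fp w by exact: max0.
have fn0 w : 0 <= fn w by exact: max0.
have hp0 w : 0 <= hp w by exact: max0.
have hn0 w : 0 <= hn w by exact: max0.
have key : (\int[mu]_w (hp w)%:E + \int[mu]_w (fn w)%:E =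
    \int[mu]_w (hn w)%:E + (\int[mu]_w (fp w)%:E + \int[mu]_w (g w)%:E))%E.
  rewrite -!ge0_integralD//; 
    try (by move=> w _; rewrite ?adde_ge0// lee_fin); last by apply: emeasurable_funD.
  apply: eq_integral => w _; rewrite -!EFinD; congr EFin.
  rewrite /hp /hn /fp /fn; have := g0 w.
    by case: (leP (f w + g w) 0); case: (leP (f w) 0);
       case: (leP (- (f w + g w)) 0); case: (leP (- f w) 0); lra.
have ip : mu.-integrable setT (EFin \o fp).
  apply: le_integrable intf => // w _ /=; rewrite lee_fin ger0_norm//.
  by rewrite ge_max ler_norm normr_ge0.
have in_ : mu.-integrable setT (EFin \o fn).
  apply: le_integrable intf => // w _ /=; rewrite lee_fin ger0_norm//.
  by rewrite ge_max normr_ge0 andbT -normrN ler_norm.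
(* As [g] is nonnegative, the negative part of [f + g] is at most that of [f]. *)
have ihn : mu.-integrable setT (EFin \o hn).
  apply: le_integrable in_ => // w _ /=; rewrite lee_fin !ger0_norm//.
  by rewrite ge_max le_max max0 andbT opprD gerDl oppr_le0 g0.
have E (F : T -> R) : (\int[mu]_w (F w)%:E =
    \int[mu]_w (Num.max (F w) 0)%:E - \int[mu]_w (Num.max (- F w) 0)%:E)%E.
  rewrite integralE; congr (_ - _)%E; apply: eq_integral => w _.
    by rewrite funeposE EFin_max.
  by rewrite funenegE EFin_max.
rewrite (E f) (E (fun w => f w + g w)).
have /fineK := integrable_fin_num measurableT ip.
have /fineK := integrable_fin_num measurableT in_.
have /fineK := integrable_fin_num measurableT ihn.
move: key; rewrite /fp /fn /hp /hn /= => + a b c; rewrite -a -b -c.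
set A := (\int[mu]_w (Num.max (f w + g w) 0)%:E)%E.
set G := (\int[mu]_w (g w)%:E)%E.
(* Only [A] and [G] can still be infinite, and [key] forces them to be so together. *)
case: A => [x||]; case: G => [y||] //=.
  by rewrite -!EFinD => -[key]; congr EFin; lra.
Qed.

(** * The sample space with the events generated by a process *)

Section generated_space.
Context {d d' : measure_display} {T : measurableType d} {U : measurableType d'}
  {I : Type}.
Variables (times : set I) (Z : I -> T -> U).

(** This replaces a path space: the points are those of [T], but only events determined by the
    process are kept. The identity maps into two such spaces are the independent maps to which
    decoupling is applied. *)
Definition process_space :=
  g_sigma_algebraType (\bigcup_(i in times) g_sigma_algebra_preimage (Z i)).

Hypothesis mZ : forall i, times i -> measurable_fun setT (Z i).

Lemma process_sigma_measurable A : process_sigma times Z A -> measurable A.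
Proof.
apply: smallest_sub; first exact: sigma_algebra_measurable.
by move=> B [i ti [C mC <-]]; exact: mZ.
Qed.

Lemma measurable_to_process_space :
  measurable_fun setT (id : T -> process_space).
Proof. by move=> _ A mA; rewrite setTI; exact: process_sigma_measurable. Qed.

Lemma measurable_from_process_space i : times i ->
  measurable_fun setT (Z i : process_space -> U).
Proof.
by move=> ti _ A mA; apply: sub_sigma_algebra; exists i => //; exists A.
Qed.

End generated_space.

(** * Integrable variables with known mean and bounded absolute moment *)

Section mean_bound.
Context {d : measure_display} {T : measurableType d} {R : realType}.
Variable P : probability T R.

(** The bound is explicit, not mere finiteness: when [f] depends on a frozen conditioning value, so
    does [B], and integrability of [B] in that value yields joint integrability. *)
Definition mean_bound (f : T -> R) (m B : R) : Prop :=
  [/\ measurable_fun setT f, (\int[P]_w `|(f w)%:E| <= B%:E)%E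
    & (\int[P]_w (f w)%:E = m%:E)%E].

Lemma mean_bound_integrable f m B :
  mean_bound f m B -> P.-integrable setT (EFin \o f).
Proof.
move=> [mf fB _]; apply/integrableP; split; first exact/measurable_EFinP.
by apply: (le_lt_trans fB); rewrite ltry.
Qed.

Lemma integrable_mean_bound f : P.-integrable setT (EFin \o f) ->
  mean_bound f (fine (\int[P]_w (f w)%:E)) (fine (\int[P]_w `|(f w)%:E|)).
Proof.
move=> intf; split.
- by apply/measurable_EFinP; exact: measurable_int intf.
- by rewrite fineK//; have := integrable_abse intf; exact: integrable_fin_num.
- by rewrite fineK//; exact: integrable_fin_num.
Qed.

Lemma eq_mean_bound f g m m' B B' : f =1 g -> m = m' -> B = B' ->
  mean_bound f m B -> mean_bound g m' B'.
Proof. by move=> /funext -> -> ->. Qed.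

Lemma mean_bound_cst c : mean_bound (cst c) c `|c|.
Proof.
split => //.
- have /= := integral_cst P measurableT `|c|%:E.
  by rewrite probability_setT mule1 => ->.
- have /= := integral_cst P measurableT c%:E.
  by rewrite probability_setT mule1 => ->.
Qed.

Lemma mean_boundD f g m m' B B' : mean_bound f m B -> mean_bound g m' B' ->
  mean_bound (fun w => f w + g w) (m + m') (B + B').
Proof.
move=> hf hg; have [mf fB fm] := hf; have [mg gB gm] := hg; split.
- exact: measurable_funD.
- apply: (@le_trans _ _ (\int[P]_w (`|(f w)%:E| + `|(g w)%:E|))%E).
    apply: ge0_le_integral => //.
    + by apply: measurableT_comp => //; apply/measurable_EFinP; exact: measurable_funD.
    + by apply: emeasurable_funD; apply: measurableT_comp => //; exact/measurable_EFinP.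
    + by move=> w _; rewrite EFinD lee_abs_add.
  rewrite ge0_integralD//; last 2 first.
  + by apply: measurableT_comp => //; exact/measurable_EFinP.
  + by apply: measurableT_comp => //; exact/measurable_EFinP.
  by rewrite EFinD leeD.
- under eq_integral do rewrite EFinD.
  rewrite integralD//; [by rewrite fm gm|exact: mean_bound_integrable hf|].
  exact: mean_bound_integrable hg.
Qed.

Lemma mean_boundZ f c m B : mean_bound f m B ->
  mean_bound (fun w => c * f w) (c * m) (`|c| * B).
Proof.
move=> hf; have [mf fB fm] := hf; split.
- exact: measurable_funM.
- under eq_integral do rewrite EFinM abseM.
  rewrite ge0_integralZl//; last by apply: measurableT_comp => //; exact/measurable_EFinP.
  by rewrite EFinM lee_wpmul2l// abse_ge0.
- under eq_integral do rewrite EFinM.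
  by rewrite integralZl//; [rewrite fm|exact: mean_bound_integrable hf].
Qed.

Lemma mean_bound_sum (I : Type) (s : seq I) (p : pred I) (f : I -> T -> R)
    (m B : I -> R) : (forall i, p i -> mean_bound (f i) (m i) (B i)) ->
  mean_bound (fun w => \sum_(i <- s | p i) f i w) (\sum_(i <- s | p i) m i)
    (\sum_(i <- s | p i) B i).
Proof.
move=> hf; elim: s => [|i s IH].
  have := mean_bound_cst 0; apply: eq_mean_bound; rewrite ?big_nil ?normr0//.
  by move=> w; rewrite big_nil.
rewrite !big_cons; case: ifPn => pi.
  have := mean_boundD (hf _ pi) IH; apply: eq_mean_bound => // w.
  by rewrite big_cons pi.
by apply: eq_mean_bound IH => // w; rewrite big_cons (negbTE pi).
Qed.

(** Decoupling is used twice: the Tonelli form factors the absolute moment and so gives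
    integrability, after which the Fubini form factors the mean. *)
Lemma mean_boundM f g m m' B B' :
  (forall C D, measurable C -> measurable D ->
     P (f @^-1` C `&` g @^-1` D) = (P (f @^-1` C) * P (g @^-1` D))%E) ->
  mean_bound f m B -> mean_bound g m' B' ->
  mean_bound (fun w => f w * g w) (m * m') (B * B').
Proof.
move=> fg hf hg; have [mf fB fm] := hf; have [mg gB gm] := hg.
have mfg : measurable_fun setT (fun w => f w * g w) by exact: measurable_funM.
have mh : measurable_fun setT (fun z : R * R => (z.1 * z.2)%:E).
  by apply/measurable_EFinP; apply: measurable_funM.
have fgB : (\int[P]_w `|(f w * g w)%:E| <= (B * B')%:E)%E.
  rewrite (decouple_ge0 mf mg fg (h := fun z : R * R => `|(z.1 * z.2)%:E|)%E)//;
    last by apply: measurableT_comp.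
  have maf : measurable_fun setT (fun w => `|(f w)%:E|)%E.
    by apply: measurableT_comp => //; exact/measurable_EFinP.
  have mag : measurable_fun setT (fun w => `|(g w)%:E|)%E.
    by apply: measurableT_comp => //; exact/measurable_EFinP.
  rewrite (eq_integral (fun w2 => (\int[P]_w1 `|(f w1)%:E|) * `|(g w2)%:E|)%E).
    rewrite ge0_integralZl//; last exact: integral_ge0.
    by rewrite EFinM lee_pmul//; exact: integral_ge0.
  move=> w2 _ /=; rewrite -ge0_integralZr//.
  by apply: eq_integral => w1 _; rewrite normrM EFinM.
split => //.
have ifg : P.-integrable setT (fun w => (f w * g w)%:E).
  apply/integrableP; split; first exact/measurable_EFinP.
  by apply: (le_lt_trans fgB); rewrite ltry.
rewrite (@decouple_integrable _ _ _ _ _ _ _ P _ _ mf mg fg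
  (fun z : R * R => (z.1 * z.2)%:E) (fun w => (m * g w)%:E))//; last 2 first.
- by apply/measurable_EFinP; exact: measurable_funM.
- apply: aeW => w2 /=.
  have h := mean_boundZ (g w2) hf.
  have [_ _ h2] := h; split.
    by apply: eq_integrable (mean_bound_integrable h) => // w1 _ /=; rewrite mulrC.
  by rewrite mulrC -h2; apply: eq_integral => w1 _; rewrite mulrC.
by have [_ _] := mean_boundZ m hg.
Qed.

(** Since [(f - g)^2] and [(f + g)^2] are nonnegative, [|f g|] is dominated by [f^2 + g^2]. *)
Lemma integrable_mul_sqr (f g : T -> R) :
  measurable_fun setT f -> measurable_fun setT g ->
  (\int[P]_w ((f w) ^+ 2)%:E < +oo)%E -> (\int[P]_w ((g w) ^+ 2)%:E < +oo)%E ->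
  P.-integrable setT (fun w => (f w * g w)%:E).
Proof.
move=> mf mg f2 g2.
have mf2 : measurable_fun setT (fun w => (f w ^+ 2)%:E).
  by apply/measurable_EFinP; exact: measurable_funX.
have mg2 : measurable_fun setT (fun w => (g w ^+ 2)%:E).
  by apply/measurable_EFinP; exact: measurable_funX.
apply/integrableP; split; first by apply/measurable_EFinP; exact: measurable_funM.
apply: (@le_lt_trans _ _ (\int[P]_w ((f w ^+ 2)%:E + (g w ^+ 2)%:E))%E).
  apply: ge0_le_integral => //.
  - by apply: measurableT_comp => //; apply/measurable_EFinP; exact: measurable_funM.
  - exact: emeasurable_funD.
  - move=> w _; rewrite -EFinD /= lee_fin ler_norml.
    have := sqr_ge0 (f w + g w); have := sqr_ge0 (f w - g w).
    have := sqr_ge0 (f w); have := sqr_ge0 (g w); nra.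
rewrite ge0_integralD//; first exact: lte_add_pinfty.
- by move=> w _; rewrite lee_fin sqr_ge0.
- by move=> w _; rewrite lee_fin sqr_ge0.
Qed.

End mean_bound.

(** * Integer-valued variables and Poisson moments *)

Section nat_valued.
Context {d : measure_display} {T : measurableType d} {R : realType}.
Variable P : probability T R.

Lemma measurable_natr (K : T -> nat) : measurable_fun setT K ->
  measurable_fun setT (fun w => (K w)%:R : R).
Proof. by move=> mK; apply: (@measurableT_comp _ _ _ _ _ _ (fun n : nat => n%:R : R)). Qed.

Lemma measurable_nat_fiber (K : T -> nat) :
  (forall k, measurable (K @^-1` [set k])) -> measurable_fun setT K.
Proof.
move=> mK _ A _; rewrite setTI.
rewrite (_ : K @^-1` A = \bigcup_(k in A) (K @^-1` [set k])).
  by apply: bigcup_measurable => k _; exact: mK.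
by apply/seteqP; split=> [w Kw|w [k Ak /= Kw]]; [exists (K w)|rewrite /= Kw].
Qed.

Lemma integral_nat_valued (K : T -> nat) (phi : nat -> R) :
  measurable_fun setT K -> (forall k, 0 <= phi k) ->
  (\int[P]_w (phi (K w))%:E =
    \sum_(k <oo) (phi k)%:E * P [set w | K w = k])%E.
Proof.
move=> mK phi0.
have mKk k : measurable (K @^-1` [set k]).
  by rewrite -[X in measurable X]setTI; exact: mK.
rewrite (_ : setT = \bigcup_k (K @^-1` [set k])); last first.
  by apply/esym/seteqP; split => // w _; exists (K w).
have mphi : measurable_fun setT (fun w => (phi (K w))%:E).
  by apply/measurable_EFinP; apply: (@measurableT_comp _ _ _ _ _ _ phi).
rewrite ge0_integral_bigcup//; [|exact: measurable_funTS| |]; last 2 first.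
- by move=> w _; rewrite lee_fin.
- by apply/trivIsetP => i j _ _ ij; apply/seteqP; split => // w [/= -> /eqP]; rewrite (negbTE ij).
apply: eq_eseriesr => k _.
have <- := integral_cst P (mKk k) (phi k)%:E.
by apply: eq_integral => w; rewrite inE /= => ->.
Qed.

(** The ratio of consecutive Poisson weights, on which Stein's identity rests. *)
Lemma poisson_pmfS (r : R) k : 0 < r ->
  k.+1%:R * poisson_pmf r k.+1 = r * poisson_pmf r k.
Proof.
move=> r0; rewrite /poisson_pmf r0 factS natrM exprS invfM.
have k0 : (k.+1%:R : R) != 0 by rewrite pnatr_eq0.
have k1 : (k`!%:R : R) != 0 by rewrite pnatr_eq0 -lt0n fact_gt0.
by field; rewrite k1 addrC natr1 k0.
Qed.

Variables (K : T -> nat) (r : R).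
Hypotheses (mK : measurable_fun setT K) (r0 : 0 < r).
Hypothesis K_law : forall k, P [set w | K w = k] = (poisson_pmf r k)%:E.

(* Stein's identity: it gives the moments recursively. *)
Lemma poisson_stein (phi : nat -> R) : (forall k, 0 <= phi k) ->
  (\int[P]_w ((K w)%:R * phi (K w))%:E = r%:E * \int[P]_w (phi (K w).+1)%:E)%E.
Proof.
move=> phi0.
rewrite (@integral_nat_valued K (fun k => k%:R * phi k))//; last by move=> k; rewrite mulr_ge0.
rewrite (@integral_nat_valued K (fun k => phi k.+1))//.
(* The term at [k = 0] carries the factor 0; dropping it shifts the index by one. *)
rewrite (nneseries_recl (P := xpredT))//; last first.
  by move=> k _; rewrite mule_ge0// lee_fin mulr_ge0.
rewrite mul0r mul0e add0e -nneseriesZl//; last first.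
  by move=> k _; rewrite mule_ge0// lee_fin.
rewrite -nneseries_addn; last by move=> k; rewrite mule_ge0// lee_fin mulr_ge0.
apply: eq_eseriesr => k _; rewrite addn1 !K_law -!EFinM; congr EFin.
by rewrite mulrAC poisson_pmfS//; ring.
Qed.

Lemma poisson_mean : (\int[P]_w (K w)%:R%:E = r%:E)%E.
Proof.
have := @poisson_stein (fun=> 1) (fun=> ler01).
under eq_integral do rewrite mulr1.
move=> ->; have /= -> := integral_cst P measurableT 1%:E.
by rewrite probability_setT !mule1.
Qed.

Lemma poisson_sqr_mean : (\int[P]_w ((K w)%:R ^+ 2)%:E = (r ^+ 2 + r)%:E)%E.
Proof.
under eq_integral do rewrite expr2.
(* Stein's identity with [phi k = k] gives [E(K^2) = r * E(K + 1)]. *)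
rewrite (@poisson_stein (fun k => k%:R))//.
have mKr : measurable_fun setT (fun w => (K w)%:R : R) by exact: measurable_natr.
under eq_integral do rewrite -natr1 EFinD.
rewrite ge0_integralD//; last exact/measurable_EFinP.
rewrite poisson_mean; have /= -> := integral_cst P measurableT 1%:E.
by rewrite probability_setT mule1 -EFinD -EFinM mulrDr mulr1 expr2.
Qed.

End nat_valued.

Lemma ge0_mean_bound {d : measure_display} {T : measurableType d}
    {R : realType} (P : probability T R) (f : T -> R) (m : R) :
  measurable_fun setT f -> (forall w, 0 <= f w) ->
  (\int[P]_w (f w)%:E = m%:E)%E -> mean_bound P f m m.
Proof.
move=> mf f0 fm; split=> //; rewrite -fm le_eqVlt; apply/orP; left; apply/eqP.
by apply: eq_integral => w _; rewrite gee0_abs// lee_fin.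
Qed.

(** * First and second moments of the Poisson process at fixed times *)

Section poisson_process_moments.
Context {d : measure_display} {T : measurableType d} {R : realType}.
Variables (P : probability T R) (lambda : R) (N : R -> {RV P >-> nat}).
Hypotheses (lambda_gt0 : 0 < lambda) (HN : poisson_process lambda N).

Let mN t : measurable_fun setT (N t).
Proof. exact: measurable_funPT. Qed.

Lemma poisson_incr_sqr s t : 0 <= s -> s < t ->
  mean_bound P (fun w => ((N t w)%:R - (N s w)%:R) ^+ 2)
    ((lambda * (t - s)) ^+ 2 + lambda * (t - s))
    ((lambda * (t - s)) ^+ 2 + lambda * (t - s)).
Proof.
move=> s0 st; have [_ _ pmf mono _] := HN.
have mK : measurable_fun setT (fun w => N t w - N s w)%N.
  exact: measurable_fun_subn.
have r0 : 0 < lambda * (t - s) by rewrite mulr_gt0// subr_gt0.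
apply: ge0_mean_bound.
- by apply: measurable_funX; apply: measurable_funB; exact: measurable_natr.
- by move=> w; rewrite sqr_ge0.
- rewrite -(poisson_sqr_mean mK r0 (pmf s t s0 st)).
  by apply: eq_integral => w _; rewrite natrB// mono// ltW.
Qed.

Let N0_ae : {ae P, forall w, N 0 w = 0%N}.
Proof.
have [N0 _ _ _ _] := HN.
have mN0 : measurable [set w | N 0 w = 0%N].
  by have := mN 0 measurableT (Y := [set 0%N]) I; rewrite setTI.
exists (~` [set w | N 0 w = 0%N]); split => //; first exact: measurableC.
by rewrite probability_setC// N0 subee.
Qed.

Lemma poisson_mean_bound t : 0 <= t ->
  mean_bound P (fun w => (N t w)%:R) (lambda * t) (lambda * t).
Proof.
move=> t0; have [_ _ pmf mono _] := HN.
apply: ge0_mean_bound => //; first exact: measurable_natr.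
(* At time 0 no increment law is at hand, so [N 0 = 0] almost surely is used directly; for [t > 0]
   the increment from time 0 equals [N t] almost surely. *)
have [->|tn0] := eqVneq t 0.
  rewrite mulr0 -[RHS](integral0 P setT); apply: ae_eq_integral => //.
    by apply/measurable_EFinP; exact: measurable_natr.
  by apply: filterS N0_ae => w -> _.
have tp : 0 < t by rewrite lt_neqAle eq_sym tn0.
have mK : measurable_fun setT (fun w => N t w - N 0 w)%N.
  exact: measurable_fun_subn.
have r0 : 0 < lambda * (t - 0) by rewrite mulr_gt0// subr_gt0.
rewrite -[X in (lambda * X)]subr0 -(poisson_mean mK r0 (pmf 0 t (lexx 0) tp)).
apply: ae_eq_integral => //.
- by apply/measurable_EFinP; exact: measurable_natr.
- by apply/measurable_EFinP; exact: measurable_natr.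
- by apply: filterS N0_ae => w -> _; rewrite subn0.
Qed.

Lemma poisson_sqr_mean_bound t : 0 <= t ->
  mean_bound P (fun w => (N t w)%:R ^+ 2) ((lambda * t) ^+ 2 + lambda * t)
    ((lambda * t) ^+ 2 + lambda * t).
Proof.
move=> t0.
apply: ge0_mean_bound => //; first by apply: measurable_funX; exact: measurable_natr.
have [->|tn0] := eqVneq t 0.
  rewrite mulr0 expr0n add0r -[RHS](integral0 P setT); apply: ae_eq_integral => //.
    by apply/measurable_EFinP; apply: measurable_funX; exact: measurable_natr.
  by apply: filterS N0_ae => w -> _; rewrite expr0n.
have tp : 0 < t by rewrite lt_neqAle eq_sym tn0.
have [_ _] := poisson_incr_sqr (lexx 0) tp.
rewrite subr0 => <-; apply: ae_eq_integral => //.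
- by apply/measurable_EFinP; apply: measurable_funX; exact: measurable_natr.
- apply/measurable_EFinP; apply: measurable_funX; apply: measurable_funB;
    exact: measurable_natr.
- by apply: filterS N0_ae => w -> _; rewrite subr0.
Qed.

(* Polarization: the law of the increment N b - N a determines E(N a * N b). *)
Lemma poisson_mul_mean_bound a b : 0 <= a -> a <= b ->
  exists B, mean_bound P (fun w => (N a w)%:R * (N b w)%:R)
    (lambda ^+ 2 * a * b + lambda * a) B.
Proof.
move=> a0; rewrite le_eqVlt => /predU1P[<-|ab].
  eexists; apply: eq_mean_bound (poisson_sqr_mean_bound a0) => [w||]; last reflexivity.
    by rewrite expr2.
  by ring.
have b0 : 0 <= b by rewrite (le_trans a0)// ltW.
eexists; apply: eq_mean_bound (mean_boundZ (2^-1)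
  (mean_boundD (mean_boundD (poisson_sqr_mean_bound a0) (poisson_sqr_mean_bound b0))
    (mean_boundZ (-1) (poisson_incr_sqr a0 ab)))) => [w||]; last reflexivity.
  by field.
by field.
Qed.

(** The compensated process is centered, with covariance [lambda * a]. Here [a], [b] are the values
    of the inverse process at two times, once it is frozen, and [p], [q] the terms that it then
    determines. The bound stays existential: only integrability for frozen values is drawn from
    it. *)
Lemma compensated_poisson_mul a b mu p q : 0 <= a -> a <= b ->
  exists B, mean_bound P
    (fun w => (p - mu * ((N a w)%:R - lambda * a)) *
              (q - mu * ((N b w)%:R - lambda * b)))
    (p * q + mu ^+ 2 * lambda * a) B.
Proof.
move=> a0 ab; have b0 : 0 <= b by rewrite (le_trans a0).
have [B HB] := poisson_mul_mean_bound a0 ab.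
eexists; apply: eq_mean_bound (mean_boundD (mean_boundD (mean_boundD
  (mean_boundZ (mu ^+ 2) HB)
  (mean_boundZ (- mu * (q + mu * lambda * b)) (poisson_mean_bound a0)))
  (mean_boundZ (- mu * (p + mu * lambda * a)) (poisson_mean_bound b0)))
  (mean_bound_cst P ((p + mu * lambda * a) * (q + mu * lambda * b))))
  => [w||]; last reflexivity.
  by rewrite /cst; ring.
by ring.
Qed.

End poisson_process_moments.

(** * Measurability of a process evaluated at a random time *)

Section composition.
Context {dS dU dV : measure_display} {S : measurableType dS}
  {U : measurableType dU} {V : measurableType dV}.

(** The preimage splits into countably many pieces on which the index [K] is constant. *)
Lemma measurable_nat_indexed (F : nat -> U -> V) (K : S -> nat) (phi : S -> U) :
  (forall k, measurable_fun setT (F k)) -> measurable_fun setT K ->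
  measurable_fun setT phi -> measurable_fun setT (fun x => F (K x) (phi x)).
Proof.
move=> mF mK mphi _ A mA; rewrite setTI.
rewrite (_ : _ @^-1` A =
    \bigcup_k ((K @^-1` [set k]) `&` (phi @^-1` (F k @^-1` A)))).
  apply: bigcup_measurable => k _; apply: measurableI.
    by have := mK measurableT [set k] I; rewrite setTI.
  have := mF k measurableT A mA; rewrite setTI => mFA.
  by have := mphi measurableT _ mFA; rewrite setTI.
by apply/seteqP; split=> [x Ax|x [k _ [/= <-]]] //; exists (K x).
Qed.

End composition.

Section right_continuous.
Context {dS dU : measure_display} {S : measurableType dS}
  {U : measurableType dU} {R : realType}.

Lemma measurable_truncn (Z : S -> R) : measurable_fun setT Z ->
  (forall x, 0 <= Z x) -> measurable_fun setT (fun x => Num.truncn (Z x)).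
Proof.
move=> mZ Z0; apply: measurable_nat_fiber => k.
rewrite (_ : _ @^-1` _ = Z @^-1` `[k%:R, k.+1%:R[).
  by have := mZ measurableT `[k%:R, k.+1%:R[%classic (measurable_itv _); rewrite setTI.
apply/seteqP; split=> x /=; rewrite in_itv/=; first by move=> <-; exact: truncn_itv.
exact: truncn_def.
Qed.

(** The time [Z] is approximated from the right by times with countably many values, and
    right-continuity passes measurability to the limit. The map [phi] lets time and path come from
    different coordinates of a product. *)
Lemma measurable_right_continuous_indexed (F : R -> U -> R) (Z : S -> R)
    (phi : S -> U) :
  (forall t, 0 <= t -> measurable_fun setT (F t)) ->
  (forall u t, 0 <= t -> F x u @[x --> t^'+] --> F t u) ->
  measurable_fun setT Z -> (forall x, 0 <= Z x) -> measurable_fun setT phi ->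
  measurable_fun setT (fun x => F (Z x) (phi x)).
Proof.
move=> mF rcF mZ Z0 mphi.
(* The successor puts [u n z] strictly above [z], as a right limit requires, and at distance at most
   [1 / (n + 1)]. *)
pose u (n : nat) (z : R) : R := (Num.truncn (n.+1%:R * z)).+1%:R / n.+1%:R.
have n0 n : 0 < n.+1%:R :> R by rewrite ltr0n.
apply: (@measurable_fun_cvg _ _ _ _ (fun n x => F (u n (Z x)) (phi x))).
  move=> n; apply: (measurable_nat_indexed
    (F := fun k => F (k.+1%:R / n.+1%:R)) (K := fun x => Num.truncn (n.+1%:R * Z x))) => //.
    by move=> k; apply: mF; rewrite divr_ge0.
  by apply: measurable_truncn => [|x]; [exact: measurable_funM|exact: mulr_ge0].
move=> x _; have /cvg_at_rightP := rcF (phi x) (Z x) (Z0 x); apply; split.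
  by move=> n; rewrite /u ltr_pdivlMr// mulrC truncnS_gt.
apply: (@squeeze_cvgr _ _ _ _ (fun=> Z x) (fun n => Z x + n.+1%:R^-1)).
- near=> n; rewrite /u ler_pdivlMr// mulrC ltW ?truncnS_gt//=.
  rewrite ler_pdivrMr// mulrDl mulVf ?gt_eqF// -natr1 lerD2r mulrC.
  by rewrite truncn_le mulr_ge0.
- exact: cvg_cst.
- rewrite -[X in _ --> X]addr0; apply: cvgD; first exact: cvg_cst.
  exact: cvg_harmonic.
Unshelve. all: by end_near.
Qed.

End right_continuous.

(** * The inverse subordinator: measurability, second moment, monotonicity *)

Section inverse_process.
Context {d : measure_display} {T : measurableType d} {R : realType}.
Variables (P : probability T R) (alpha1 alpha2 C1 C2 : R) (D : R -> {RV P >-> R}).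
Hypotheses (C12 : C1 + C2 = 1).
Hypothesis HD : mixed_stable_subordinator alpha1 alpha2 C1 C2 D.

Local Notation Y := (inverse_process D).

Let crossing t w := [set x : R | 0 <= x /\ t < D x w].

Let D_homo w s t : 0 <= s -> s <= t -> D s w <= D t w.
Proof. by have [[_ +] _] := HD; exact. Qed.

Let crossing_lb t w : has_lbound (crossing t w).
Proof. by exists 0 => x []. Qed.

Lemma inverse_process_ge0 t w : 0 <= Y t w.
Proof.
rewrite /inverse_process -/(crossing t w).
have [->|ne] := eqVneq (crossing t w) set0; first by rewrite inf0.
by apply: lb_le_inf; [exact/set0P|move=> x []].
Qed.

Lemma inverse_process_le t w x : 0 <= x -> t < D x w -> Y t w <= x.
Proof. by move=> x0 tD; exact: (ge_inf (crossing_lb t w)). Qed.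

Let mD t : measurable_fun setT (D t).
Proof. exact: measurable_funPT. Qed.

Let mD_gt t x : measurable [set w | t < D x w].
Proof.
rewrite (_ : [set w | _] = D x @^-1` `]t, +oo[).
  by have := mD x measurableT (measurable_itv `]t, +oo[); rewrite setTI.
by apply/seteqP; split=> w /=; rewrite in_itv/= andbT.
Qed.

(** As paths are nondecreasing, crossing the level [t] can be tested at integer times. *)
Let crossing_set0 t : [set w | crossing t w = set0] = ~` \bigcup_k [set w | t < D k%:R w].
Proof.
apply/seteqP; split=> w /=.
  move=> c0 [k _ /= tD]; have : crossing t w k%:R by [].
  by rewrite c0.
move=> nc; apply/seteqP; split=> // x [x0 tDx]; apply: nc.
exists (Num.truncn x).+1 => //=; apply: (lt_le_trans tDx).
by apply: D_homo => //; rewrite ltW// truncnS_gt.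
Qed.

Let measurable_crossing_set0 t : measurable [set w | crossing t w = set0].
Proof. by rewrite crossing_set0; apply: measurableC; exact: bigcupT_measurable. Qed.

Lemma measurable_inverse_process t : measurable_fun setT (Y t).
Proof.
apply: (measurability _ (RGenInftyO.measurableE R)) => _ [_ [a ->] <-].
rewrite setTI; have [a0|a0] := leP a 0.
  rewrite (_ : _ @^-1` _ = set0)//; apply/seteqP; split=> // w /=.
  by rewrite in_itv/= ltNge (le_trans a0)// inverse_process_ge0.
(* For [a > 0], [Y t < a] means that the path exceeds [t] at a rational time in [[0, a)], or never
   does, the infimum then being 0 by default. *)
rewrite (_ : _ @^-1` _ = [set w | crossing t w = set0] `|`
  \bigcup_(q : rat) (if (0 <= ratr q :> R) && (ratr q < a)
                     then [set w | t < D (ratr q) w] else set0)).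
  apply: measurableU => //; apply: bigcupT_measurable_rat => q.
  by case: ifPn.
apply/seteqP; split=> w /=; rewrite in_itv/=.
- move=> Ya; have [->|ne] := eqVneq (crossing t w) set0; first by left.
  right; have [x [x0 tDx] xa] := inf_lt ((set0P _).1 ne) Ya.
  have [q] := rat_in_itvoo xa; rewrite in_itv/= => /andP[xq qa].
  exists q => //; rewrite qa (le_trans x0 (ltW xq))/=.
  by apply: (lt_le_trans tDx); apply: D_homo => //; exact: ltW.
- case=> [c0|[q _]]; first by rewrite /inverse_process -/(crossing t w) c0 inf0.
  case: ifPn => // /andP[q0 qa] tD; exact: (le_lt_trans (inverse_process_le q0 tD)).
Qed.

(** At [s = 1] both powers equal 1, so the Laplace exponent is [C1 + C2 = 1]. *)
Lemma laplace_inverse_process t k :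
  (\int[P]_w (expR (t - D k%:R w))%:E = (expR (t - k%:R))%:E)%E.
Proof.
have [_ /(_ 1 k%:R ler01 (ler0n _ _))] := HD.
rewrite !powR1 !mulr1 C12 mulr1 unlock => E.
under eq_integral => w _ do rewrite expRD EFinM -[D _ w]mul1r.
rewrite ge0_integralZl//.
- by rewrite E expRD EFinM.
- apply/measurable_EFinP; apply: measurableT_comp => //.
  by apply: measurableT_comp => //; exact: measurable_funM.
Qed.

(* On the event [k < Y t <= k + 2] one has [D k <= t], so that the k-th term of
   the series is at least [(k + 2)^2]; summability comes from the Laplace
   exponent being 1 at s = 1. *)
Let inverse_process_sqr_le t w : ((Y t w ^+ 2)%:E <=
  1 + \sum_(k <oo) (16 * expR (k%:R / 2) * expR (t - D k%:R w))%:E)%E.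
Proof.
have term0 k : (0 <= (16 * expR (k%:R / 2) * expR (t - D k%:R w))%:E)%E.
  by rewrite lee_fin !mulr_ge0// expR_ge0.
have Y0 := inverse_process_ge0 t w.
have [Y1|Y1] := leP (Y t w) 1.
  apply: (@le_trans _ _ 1%E); first by rewrite lee_fin expr_le1.
  by rewrite leeDl// nneseries_ge0.
(* The index used is [n.-1], not [n]: from [n <= Y t w] one gets [D x w <= t] only for [x < n]. *)
pose n := Num.truncn (Y t w).
have /andP[nY Yn] := truncn_itv Y0; rewrite -/n in nY Yn.
have n0 : (0 < n)%N by rewrite truncn_gt0 ltW.
apply: (@le_trans _ _ (16 * expR (n.-1%:R / 2) * expR (t - D n.-1%:R w))%:E).
  rewrite lee_fin.
  have tD : 0 <= t - D n.-1%:R w.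
    rewrite subr_ge0 leNgt; apply/negP => tD.
    have := inverse_process_le (ler0n _ n.-1) tD.
    by rewrite leNgt (lt_le_trans _ nY)// ltr_nat prednK.
  have e1 : 1 <= expR (t - D n.-1%:R w) by rewrite -[leLHS]expR0 ler_expR.
  (* Source of the constant 16: squaring this gives [(k + 4)^2 <= 16 * expR (k / 2)] with
     [k = n.-1]. *)
  have e2 : 1 + n.-1%:R / 4 <= expR (n.-1%:R / 4) :> R by exact: expR_ge1Dx.
  have e3 : expR (n.-1%:R / 2) = expR (n.-1%:R / 4) ^+ 2 :> R.
    by rewrite expr2 -expRD; congr expR; field.
  have e4 : Y t w <= n.-1%:R + 2.
    by rewrite (le_trans (ltW Yn))// -(prednK n0) -!natr1; lra.
  rewrite e3; apply: (@le_trans _ _ (16 * expR (n.-1%:R / 4) ^+ 2)).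
    have n1 : 0 <= n.-1%:R :> R by [].
    move: e2 e4 Y0; set e := expR _; set y := Y t w; set m := (_ %:R : R) in n1 *.
    by nra.
  by rewrite ler_peMr// mulr_ge0// exprn_ge0// expR_ge0.
apply: (@le_trans _ _ (\sum_(k <oo) (16 * expR (k%:R / 2) * expR (t - D k%:R w))%:E)%E).
  apply: le_trans (nneseries_lim_ge n _) => //.
  by rewrite -[in leRHS](prednK n0) big_nat_recr//= leeDr// sume_ge0.
by rewrite leeDr.
Qed.

Lemma inverse_process_sqr_lty t : (\int[P]_w ((Y t w) ^+ 2)%:E < +oo)%E.
Proof.
have mt k : measurable_fun setT
    (fun w => (16 * expR (k%:R / 2) * expR (t - D k%:R w))%:E).
  apply/measurable_EFinP; apply: measurable_funM => //.
  apply: measurableT_comp => //; exact: measurable_funB.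
have t0 k w : (0 <= (16 * expR (k%:R / 2) * expR (t - D k%:R w))%:E)%E.
  by rewrite lee_fin !mulr_ge0// expR_ge0.
have ms : measurable_fun setT (fun w =>
    \sum_(k <oo) (16 * expR (k%:R / 2) * expR (t - D k%:R w))%:E)%E.
  by apply: ge0_emeasurable_sum.
apply: (@le_lt_trans _ _ (\int[P]_w (1 +
    \sum_(k <oo) (16 * expR (k%:R / 2) * expR (t - D k%:R w))%:E))%E).
  apply: ge0_le_integral => //.
  - by move=> w _; rewrite lee_fin sqr_ge0.
  - by apply/measurable_EFinP; apply: measurable_funX; exact: measurable_inverse_process.
  - exact: emeasurable_funD.
rewrite ge0_integralD//; last by move=> w _; exact: nneseries_ge0.
have /= -> := integral_cst P measurableT 1%:E.
rewrite probability_setT mule1 lte_add_pinfty ?ltry//.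
rewrite integral_nneseries//.
(* The decay [expR (- k)] of the expectations beats the weight [expR (k / 2)], leaving a geometric
   series of ratio [expR (- 1 / 2)]. *)
rewrite (eq_eseriesr (g := fun k => (16 * expR t * expR (- 2^-1) ^+ k)%:E)); last first.
  move=> k _; under eq_integral => w _ do rewrite EFinM.
  rewrite ge0_integralZl//.
  - rewrite laplace_inverse_process -EFinM; congr EFin.
    by rewrite -mulrA -mulrA; congr (_ * _); rewrite -expRM_natl -!expRD; congr expR; field.
  - apply/measurable_EFinP; apply: measurableT_comp => //; exact: measurable_funB.
apply: (@le_lt_trans _ _ (16 * expR t * (1 - expR (- 2^-1))^-1)%:E); last exact: ltry.
apply: lime_le.
  by apply: is_cvg_nneseries => k _ _; rewrite lee_fin !mulr_ge0 ?exprn_ge0 ?expR_ge0.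
near=> n; rewrite sumEFin lee_fin.
apply: geometric_le_lim; rewrite ?mulr_ge0 ?expR_ge0 ?expR_gt0//.
by rewrite ger0_norm ?expR_ge0// expR_lt1 oppr_lt0 invr_gt0.
Unshelve. all: by end_near.
Qed.

(** Monotonicity can fail only where the path never exceeds [t], as [Y t] is then the default 0.
    There [expR (t - D k)] is at least 1 for every [k], so that event has probability at most
    [expR (t - k)]. *)
Lemma inverse_process_homo_ae s t : s <= t ->
  {ae P, forall w, Y s w <= Y t w}.
Proof.
move=> st; exists [set w | crossing t w = set0]; split => //.
  apply/eqP; rewrite eq_le measure_ge0 andbT; apply/lee_addgt0Pr => e e0.
  rewrite add0e.
  (* Chosen so that [expR (t - k) <= e]. *)
  pose k := (Num.truncn (t - ln e)).+1.
  apply: (@le_trans _ _ (\int[P]_w (expR (t - D k%:R w))%:E)%E).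
    rewrite -[leLHS]mul1e -integral_cst// integral_mkcond.
    apply: ge0_le_integral => //.
    - by move=> w _; rewrite patchE; case: ifP.
    - by apply/(measurable_restrictT _ _).1.
    - apply/measurable_EFinP; apply: measurableT_comp => //; exact: measurable_funB.
    - move=> w _; rewrite patchE; case: ifPn; rewrite ?lee_fin ?expR_ge0// inE.
      rewrite crossing_set0 /= => nc; rewrite ?lee_fin -[leLHS]expR0 ler_expR subr_ge0 leNgt.
      by apply/negP => tD; apply: nc; exists k.
  rewrite laplace_inverse_process lee_fin -[leRHS]lnK ?posrE// ler_expR.
  by rewrite lerBlDl -lerBlDr ltW// truncnS_gt.
move=> w /= /negP; rewrite -ltNge; apply: contraPP => /eqP/set0P ne.
apply/negP; rewrite -leNgt; apply: lb_le_inf => // x [x0 tD].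
by apply: inverse_process_le => //; exact: le_lt_trans tD.
Qed.

End inverse_process.

(** * Square-integrable variables *)

Section sqr_integrable.
Context {d : measure_display} {T : measurableType d} {R : realType}.
Variable P : probability T R.

Definition sqr_integrable (f : T -> R) : Prop :=
  measurable_fun setT f /\ (\int[P]_w (f w ^+ 2)%:E < +oo)%E.

Lemma sqr_integrable_cst c : sqr_integrable (cst c).
Proof.
split=> //; have /= -> := integral_cst P measurableT (c ^+ 2)%:E.
by rewrite probability_setT mule1 ltry.
Qed.

Lemma sqr_integrableZ c f : sqr_integrable f ->
  sqr_integrable (fun w => c * f w).
Proof.
move=> [mf f2]; split; first exact: measurable_funM.
under eq_integral do rewrite exprMn EFinM.
rewrite ge0_integralZl//.
- by rewrite lte_mul_pinfty// lee_fin sqr_ge0.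
- by apply/measurable_EFinP; exact: measurable_funX.
- by move=> w _; rewrite lee_fin sqr_ge0.
- by rewrite lee_fin sqr_ge0.
Qed.

Lemma sqr_integrableD f g : sqr_integrable f -> sqr_integrable g ->
  sqr_integrable (fun w => f w + g w).
Proof.
move=> sf sg; have [mf _] := sf; have [mg _] := sg.
have [m2f f2] := sqr_integrableZ 2 sf; have [m2g g2] := sqr_integrableZ 2 sg.
have mX (h : T -> R) : measurable_fun setT h ->
    measurable_fun setT (fun w => (h w ^+ 2)%:E).
  by move=> mh; apply/measurable_EFinP; exact: measurable_funX.
split; first exact: measurable_funD.
apply: (@le_lt_trans _ _ (\int[P]_w (((2 * f w) ^+ 2)%:E + ((2 * g w) ^+ 2)%:E))%E).
  apply: ge0_le_integral => //.
  - by move=> w _; rewrite lee_fin sqr_ge0.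
  - by apply: mX; exact: measurable_funD.
  - by apply: emeasurable_funD; exact: mX.
  - move=> w _; rewrite -EFinD lee_fin.
    by have := sqr_ge0 (f w - g w); nra.
rewrite ge0_integralD//; first exact: lte_add_pinfty.
- by move=> w _; rewrite lee_fin sqr_ge0.
- exact: mX.
- by move=> w _; rewrite lee_fin sqr_ge0.
- exact: mX.
Qed.

Lemma sqr_integrable_norm f : sqr_integrable f ->
  sqr_integrable (fun w => `|f w|).
Proof.
move=> [mf f2]; split; first exact: measurableT_comp.
by under eq_integral do rewrite real_normK ?num_real//.
Qed.

Lemma sqr_integrableM f g : sqr_integrable f -> sqr_integrable g ->
  P.-integrable setT (fun w => (f w * g w)%:E).
Proof. by move=> [mf f2] [mg g2]; exact: integrable_mul_sqr. Qed.

Lemma sqr_integrable_integrable f : sqr_integrable f ->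
  P.-integrable setT (EFin \o f).
Proof.
move=> sf; have := sqr_integrableM sf (sqr_integrable_cst 1).
by apply: eq_integrable => // w _ /=; rewrite mulr1.
Qed.

End sqr_integrable.

(** * Transfer of integrals between identically distributed variables *)

Section same_law.
Context {d d' : measure_display} {T : measurableType d} {U : measurableType d'}
  {R : realType}.
Variables (P : probability T R) (X1 X2 : {RV P >-> U}).
Hypothesis X12 : same_law P X1 X2.

Let same_distribution (A : set U) : measurable A ->
  distribution P X1 A = distribution P X2 A.
Proof. exact: X12. Qed.

Lemma same_law_ge0_integral (f : U -> \bar R) :
  measurable_fun setT f -> (forall y, 0 <= f y)%E ->
  (\int[P]_w f (X1 w) = \int[P]_w f (X2 w))%E.
Proof.
move=> mf f0; rewrite -[LHS](ge0_integral_distribution X1 mf f0).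
rewrite -[RHS](ge0_integral_distribution X2 mf f0).
by apply: eq_measure_integral => A mA _; exact: same_distribution.
Qed.

Lemma same_law_integrable (f : U -> \bar R) : measurable_fun setT f ->
  P.-integrable setT (f \o X2) -> P.-integrable setT (f \o X1).
Proof.
move=> mf /integrableP[_ fX2]; apply/integrableP; split.
  exact: measurableT_comp.
have /= -> := same_law_ge0_integral (f := fun y => `|f y|%E) => //.
exact: measurableT_comp.
Qed.

Lemma same_law_integral (f : U -> \bar R) : measurable_fun setT f ->
  P.-integrable setT (f \o X2) ->
  (\int[P]_w f (X1 w) = \int[P]_w f (X2 w))%E.
Proof.
move=> mf fX2; have fX1 := same_law_integrable mf fX2.
rewrite -[LHS](integral_distribution mf fX1) -[RHS](integral_distribution mf fX2).
by apply: eq_measure_integral => A mA _; exact: same_distribution.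
Qed.

End same_law.

(** * Sums of centered, pairwise uncorrelated variables *)

Section centered_sums.
Context {d : measure_display} {T : measurableType d} {R : realType}.
Variables (P : probability T R) (xi : nat -> T -> R) (c : R).
Hypothesis xi_mean : forall i, mean_bound P (xi i) 0 c.
Hypothesis xi_uncorrelated : forall i j, i != j ->
  mean_bound P (fun w => xi i w * xi j w) 0 (c * c).

(** The bound is affine in [m], hence square integrable once [m] becomes the claim count. *)
Lemma mean_bound_sub_sum b m :
  mean_bound P (fun w => b - \sum_(i < m) xi i w) b (`|b| + m%:R * c).
Proof.
apply: eq_mean_bound (mean_boundD (mean_bound_cst P b) (mean_boundZ (-1)
  (mean_bound_sum (index_enum 'I_m) (p := xpredT) (fun i _ => xi_mean i)))).
- by move=> w; rewrite mulN1r.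
- by rewrite big1// mulr0 addr0.
- by rewrite normrN1 mul1r sumr_const card_ord mulr_natl.
Qed.

Lemma sum_mul_offdiag (x : nat -> R) m m' : (m <= m')%N ->
  (\sum_(i < m) x i) * (\sum_(i < m') x i) = \sum_(i < m) x i ^+ 2 +
    \sum_(i < m) \sum_(j < m') (if i == j :> nat then 0 else x i * x j).
Proof.
move=> mm'; rewrite mulr_suml -big_split; apply: eq_bigr => i _ /=.
rewrite mulr_sumr (bigD1 (widen_ord mm' i))//= -expr2; congr (_ + _).
rewrite [RHS](bigD1 (widen_ord mm' i))//= eqxx add0r.
apply: eq_bigr => j ji; case: eqP => // ij; case/eqP: ji.
by apply/val_inj; rewrite /= ij.
Qed.

(** The squares on the diagonal, possibly of infinite mean, are subtracted; what remains is [b * b']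
    plus terms of mean zero. *)
Lemma mean_bound_mul_sub_sum b b' m m' : 0 <= c -> (m <= m')%N ->
  mean_bound P (fun w => (b - \sum_(i < m) xi i w) * (b' - \sum_(i < m') xi i w)
      - \sum_(i < m) xi i w ^+ 2)
    (b * b') ((`|b| + m%:R * c) * (`|b'| + m'%:R * c)).
Proof.
move=> c0 mm'.
(* The zero diagonal entries also receive the bound [c * c], so that the total bound factors into
   two affine terms. *)
have offdiag i j : mean_bound P
    (fun w => if i == j :> nat then 0 else xi i w * xi j w) 0 (c * c).
  case: eqVneq => [_|/xi_uncorrelated//].
  have [mz zB z0] := mean_bound_cst P 0; split=> //.
  by apply: (le_trans zB); rewrite normr0 lee_fin mulr_ge0.
have sum_xi k := mean_bound_sum (index_enum 'I_k) (p := xpredT) (fun i _ => xi_mean i).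
apply: eq_mean_bound (mean_boundD (mean_boundD (mean_boundD
  (mean_bound_cst P (b * b')) (mean_boundZ (- b) (sum_xi m')))
  (mean_boundZ (- b') (sum_xi m)))
  (mean_bound_sum (index_enum 'I_m) (p := xpredT) (fun i _ =>
    mean_bound_sum (index_enum 'I_m') (p := xpredT) (fun j _ => offdiag i j)))).
- move=> w /=; have := sum_mul_offdiag (fun i => xi i w) mm'.
  by move=> H; rewrite mulrBl !mulrBr [X in _ - (_ - X)]H; ring.
- by rewrite !big1 ?mulr0 ?addr0// => i _; rewrite big1.
- rewrite !sumr_const !card_ord !normrN normrM.
  by rewrite -(mulr_natl c m) -(mulr_natl c m') -(mulr_natl (c * c) m')
    -(mulr_natl (m'%:R * _) m); ring.
Qed.

End centered_sums.

(** * Moments of the centered iid claims *)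

Section iid.
Context {d : measure_display} {T : measurableType d} {R : realType}.
Variable P : probability T R.

Lemma independent_family_pair {d' : measure_display} {U : measurableType d'}
    (X : nat -> T -> U) i j (A B : set U) :
  independent_family P X -> i != j -> measurable A -> measurable B ->
  P (X i @^-1` A `&` X j @^-1` B) = (P (X i @^-1` A) * P (X j @^-1` B))%E.
Proof.
move=> indX ij mA mB; pose F k := if k == i then A else B.
have mF k : measurable (F k) by rewrite /F; case: ifP.
have uij : uniq [:: i; j] by rewrite /= inE ij.
have Fi : F i = A by rewrite /F eqxx.
have Fj : F j = B by rewrite /F eq_sym (negbTE ij).
have := indX [:: i; j] uij F mF.
rewrite !big_cons big_nil mule1 Fi Fj => <-; congr (P _).
apply/seteqP; split=> w /=.
  by move=> [Aw Bw] k /=; rewrite !inE => /orP[]/eqP->; rewrite /= ?Fi ?Fj.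
by move=> h; split; [rewrite -Fi|rewrite -Fj]; apply: h; rewrite /= !inE eqxx ?orbT.
Qed.

Variables (X : nat -> {RV P >-> R}) (mu : R).
Hypotheses (X_indep : independent_family P (fun i => X i))
  (X_law : forall i, same_law P (X i) (X 0%N))
  (X_int : P.-integrable setT (EFin \o X 0%N))
  (X_mean : 'E_P[X 0%N]%E = mu%:E).

Let mshift : measurable_fun setT (fun x : R => x - mu).
Proof. exact: measurable_funB. Qed.

Let X_mean_int : (\int[P]_w (X 0%N w)%:E = mu%:E)%E.
Proof. by rewrite -X_mean unlock. Qed.

Lemma centered_mean_bound i :
  mean_bound P (fun w => X i w - mu) 0 (fine (\int[P]_w `|(X 0%N w - mu)%:E|)%E).
Proof.
have int0 : P.-integrable setT (fun w => (X 0%N w - mu)%:E).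
  apply: eq_integrable (integrableD measurableT X_int
    (mean_bound_integrable (mean_bound_cst P (- mu)))) => //.
have mf : measurable_fun setT (fun x : R => (x - mu)%:E) by exact/measurable_EFinP.
split; first exact: measurable_funB.
- rewrite (same_law_ge0_integral (X_law i) (f := fun x => `|(x - mu)%:E|%E))//.
    by rewrite fineK//; exact: (integrable_fin_num measurableT (integrable_abse int0)).
  exact: measurableT_comp.
- rewrite (same_law_integral (X_law i) mf)//.
  under eq_integral do rewrite EFinB.
  rewrite integralB//; last exact: (mean_bound_integrable (mean_bound_cst P mu)).
  rewrite X_mean_int; have /= -> := integral_cst P measurableT mu%:E.
  by rewrite probability_setT mule1 subee.
Qed.

Lemma centered_uncorrelated i j : i != j ->
  let c := fine (\int[P]_w `|(X 0%N w - mu)%:E|)%E in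
  mean_bound P (fun w => (X i w - mu) * (X j w - mu)) 0 (c * c).
Proof.
move=> ij c; rewrite -[0](mul0r 0).
apply: (mean_boundM _ (centered_mean_bound i) (centered_mean_bound j)) => A B mA mB.
have sh C : measurable C -> measurable ((fun x : R => x - mu) @^-1` C).
  by move=> mC; have := mshift measurableT mC; rewrite setTI.
exact: (independent_family_pair X_indep ij (sh _ mA) (sh _ mB)).
Qed.

(** Write [X^2] as [(X - mu)^2] plus [2 mu X - mu^2], which is integrable with mean [mu^2]; the
    identity thus covers an infinite second moment. *)
Lemma second_moment_centered :
  (\int[P]_w (X 0%N w ^+ 2)%:E = \int[P]_w ((X 0%N w - mu) ^+ 2)%:E + (mu ^+ 2)%:E)%E.
Proof.
have lin : mean_bound P (fun w => 2 * mu * X 0%N w - mu ^+ 2) (mu ^+ 2)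
    (`|2 * mu| * fine (\int[P]_w `|(X 0%N w)%:E|)%E + `|- mu ^+ 2|).
  apply: eq_mean_bound (mean_boundD (mean_boundZ (2 * mu) (integrable_mean_bound X_int))
    (mean_bound_cst P (- mu ^+ 2))) => //.
  by rewrite /= X_mean_int /=; ring.
have [_ _ lin_mean] := lin.
rewrite -lin_mean addeC -integralD_ge0r.
- by apply: eq_integral => w _; congr EFin; ring.
- exact: mean_bound_integrable lin.
- by apply: measurable_funX; exact: measurable_funB.
- by move=> w; exact: sqr_ge0.
Qed.

End iid.

(** * First level of randomness: the Poisson process given the inverse subordinator *)

Section mixed_process.
Context {d : measure_display} {T : measurableType d} {R : realType}.
Variables (P : probability T R) (alpha1 alpha2 C1 C2 lambda : R).
Variables (D : R -> {RV P >-> R}) (N : R -> {RV P >-> nat}).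
Hypotheses (C12 : C1 + C2 = 1) (lambda_gt0 : 0 < lambda).
Hypothesis HD : mixed_stable_subordinator alpha1 alpha2 C1 C2 D.
Hypothesis HN : poisson_process lambda N.
Hypothesis HNY : independent_sigma P
  (process_sigma [set t : R | 0 <= t] (fun t => N t))
  (process_sigma [set t : R | 0 <= t] (inverse_process D)).

Local Notation Y := (inverse_process D).
Local Notation M := (mfpp D N).

Let mY t : measurable_fun setT (Y t).
Proof. exact: measurable_inverse_process HD t. Qed.

Let mN t : measurable_fun setT (N t).
Proof. exact: measurable_funPT. Qed.

Let N_right_continuous w t : 0 <= t ->
  (N x w)%:R @[x --> t^'+] --> ((N t w)%:R : R).
Proof. by move=> t0; have [_ _ _ _ /(_ w t t0)[]] := HN. Qed.

Lemma measurable_mfpp t : measurable_fun setT (M t).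
Proof.
have mMr : measurable_fun setT (fun w => (M t w)%:R : R).
  apply: (measurable_right_continuous_indexed (F := fun a w => (N a w)%:R : R)
    (Z := Y t) (phi := id)) => //.
  - by move=> a _; exact: measurable_natr.
  - by move=> w; exact: (inverse_process_ge0 D).
apply: measurable_nat_fiber => k.
have := mMr measurableT [set k%:R] (measurable_set1 _).
rewrite setTI; congr measurable; apply/seteqP; split=> w /=; last by move=> ->.
by move/eqP; rewrite eqr_nat => /eqP.
Qed.

Let TN := process_space [set t : R | 0 <= t] (fun t => N t).
Let TY := process_space [set t : R | 0 <= t] Y.

Let mTN : measurable_fun setT (id : T -> TN).
Proof. by apply: measurable_to_process_space => t _; exact: mN. Qed.

Let mTY : measurable_fun setT (id : T -> TY).
Proof. by apply: measurable_to_process_space => t _; exact: mY. Qed.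

Let indep_NY (A : set TN) (B : set TY) : measurable A -> measurable B ->
  P ((id : T -> TN) @^-1` A `&` (id : T -> TY) @^-1` B) =
  (P ((id : T -> TN) @^-1` A) * P ((id : T -> TY) @^-1` B))%E.
Proof. exact: HNY. Qed.

Let mYs t : 0 <= t -> measurable_fun setT (fun z : TN * TY => Y t z.2).
Proof.
move=> t0; apply: (measurableT_comp (f := (Y t : TY -> R))) => //.
exact: measurable_from_process_space.
Qed.

(** In the decoupled count, the Poisson path is read from the first coordinate and the random time
    from the second. *)
Let mMs t : 0 <= t ->
  measurable_fun setT (fun z : TN * TY => (N (Y t z.2) z.1)%:R : R).
Proof.
move=> t0.
apply: (measurable_right_continuous_indexed (U := TN) (F := fun a w => (N a w)%:R : R)
    (Z := fun z : TN * TY => Y t z.2) (phi := fst)) => //.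
- by move=> a a0; apply: measurable_natr; exact: measurable_from_process_space.
- exact: mYs.
- by move=> w; exact: (inverse_process_ge0 D).
Qed.

Lemma sqr_integrable_inverse_process t : sqr_integrable P (Y t).
Proof. by split; [exact: mY|exact: inverse_process_sqr_lty C12 HD t]. Qed.

Let y t := fine (\int[P]_w (Y t w)%:E)%E.

Lemma integral_mfpp t : 0 <= t ->
  (\int[P]_w (M t w)%:R%:E = (lambda * fine (\int[P]_w (Y t w)%:E)%E)%:E)%E.
Proof.
move=> t0.
have iY := sqr_integrable_integrable (sqr_integrable_inverse_process t).
rewrite (decouple_ge0 mTN mTY indep_NY
  (h := fun z : TN * TY => (N (Y t z.2) z.1)%:R%:E))//; last by apply/measurable_EFinP; exact: mMs.
rewrite (eq_integral (fun w2 => lambda%:E * (Y t w2)%:E)%E).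
  rewrite integralZl// EFinM fineK//; exact: integrable_fin_num.
move=> w2 _; rewrite -EFinM /=.
by have [] := poisson_mean_bound lambda_gt0 HN (inverse_process_ge0 D t w2).
Qed.

Lemma sqr_integrable_mfpp t : 0 <= t -> sqr_integrable P (fun w => (M t w)%:R).
Proof.
move=> t0; split; first by apply: measurable_natr; exact: measurable_mfpp.
have sY := sqr_integrable_inverse_process t.
(* The conditional second moment [(lambda Y)^2 + lambda Y] is at most [(lambda Y + 1)^2]. *)
have [_ sY1] := sqr_integrableD (sqr_integrableZ lambda sY) (sqr_integrable_cst P 1).
rewrite (decouple_ge0 mTN mTY indep_NY
  (h := fun z : TN * TY => ((N (Y t z.2) z.1)%:R ^+ 2)%:E))//; last first.
  by apply/measurable_EFinP; apply: measurable_funX; exact: mMs.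
apply: le_lt_trans sY1; apply: ge0_le_integral => //.
- by move=> w2 _; apply: integral_ge0 => w1 _; rewrite lee_fin sqr_ge0.
- apply: (measurable_decoupled_ge0 P mTN mTY
    (h := fun z : TN * TY => ((N (Y t z.2) z.1)%:R ^+ 2)%:E)) => //.
  + by apply/measurable_EFinP; apply: measurable_funX; exact: mMs.
- apply/measurable_EFinP; apply: measurable_funX; apply: measurable_funD => //.
  exact: measurable_funM.
- move=> w2 _; have Y0 := inverse_process_ge0 D t w2.
  have [_ _ /= ->] := poisson_sqr_mean_bound lambda_gt0 HN Y0.
  rewrite lee_fin /=; have : 0 <= lambda * Y t w2 by rewrite mulr_ge0// ltW.
  by nra.
Qed.

(* The conditional expectation of the risk process given Y and N(Y), centered. *)
Definition conditional_risk (beta mu t : R) (w : T) : R :=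
  beta * (Y t w - fine (\int[P]_w (Y t w)%:E)%E) -
  mu * ((M t w)%:R - lambda * Y t w).

Lemma sqr_integrable_conditional_risk beta mu t : 0 <= t ->
  sqr_integrable P (conditional_risk beta mu t).
Proof.
move=> t0; have sY := sqr_integrable_inverse_process t.
have := sqr_integrableD (sqr_integrableD
  (sqr_integrableZ (beta + mu * lambda) sY)
  (sqr_integrableZ (- mu) (sqr_integrable_mfpp t0)))
  (sqr_integrable_cst P (- (beta * y t))).
congr sqr_integrable; apply/funext => w; rewrite /conditional_risk /y /=; ring.
Qed.

Lemma integral_conditional_risk beta mu t : 0 <= t ->
  (\int[P]_w (conditional_risk beta mu t w)%:E = 0)%E.
Proof.
move=> t0; have sY := sqr_integrable_inverse_process t.
have hY := integrable_mean_bound (sqr_integrable_integrable sY).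
have hM := integrable_mean_bound (sqr_integrable_integrable (sqr_integrable_mfpp t0)).
have [_ _] := mean_boundD (mean_boundD
  (mean_boundZ (beta + mu * lambda) hY) (mean_boundZ (- mu) hM))
  (mean_bound_cst P (- (beta * y t))).
rewrite integral_mfpp//= -/(y t) => H.
transitivity (\int[P]_w ((beta + mu * lambda) * Y t w + - mu * (M t w)%:R - beta * y t)%:E)%E.
  by apply: eq_integral => w _; rewrite /conditional_risk -/(y t); congr EFin; ring.
by rewrite H; congr EFin; ring.
Qed.

(** With the inverse process frozen, the product has mean [beta^2] times the product of the centered
    [Y s], [Y t], plus [mu^2 * lambda * Y s]; the last term integrates to [mu^2] times the mean
    count. *)
Lemma integral_conditional_risk_mul beta mu s t : 0 <= s -> s <= t ->
  (\int[P]_w (conditional_risk beta mu s w * conditional_risk beta mu t w)%:E =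
   (beta ^+ 2)%:E * covariance P (Y s) (Y t) +
   (mu ^+ 2)%:E * \int[P]_w (M s w)%:R%:E)%E.
Proof.
move=> s0 st; have t0 : 0 <= t by rewrite (le_trans s0).
have sYs := sqr_integrable_inverse_process s.
have sYt := sqr_integrable_inverse_process t.
have sc r : sqr_integrable P (fun w => Y r w - y r).
  exact: sqr_integrableD (sqr_integrable_inverse_process r) (sqr_integrable_cst P (- y r)).
have icov := integrable_mean_bound (sqr_integrableM (sc s) (sc t)).
have hY := integrable_mean_bound (sqr_integrable_integrable sYs).
have hlin := mean_boundD (mean_boundZ (beta ^+ 2) icov)
  (mean_boundZ (mu ^+ 2 * lambda) hY).
have mb r : 0 <= r -> measurable_fun setT (fun z : TN * TY =>
    beta * (Y r z.2 - y r) - mu * ((N (Y r z.2) z.1)%:R - lambda * Y r z.2)).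
  move=> r0; apply: measurable_funB.
    by apply: measurable_funM => //; apply: measurable_funB => //; exact: mYs.
  apply: measurable_funM => //; apply: measurable_funB; first exact: mMs.
  by apply: measurable_funM => //; exact: mYs.
have [mlin _ lin_mean] := hlin.
rewrite (decouple_integrable mTN mTY indep_NY
  (h := fun z : TN * TY => ((beta * (Y s z.2 - y s) - mu * ((N (Y s z.2) z.1)%:R - lambda * Y s z.2))
   * (beta * (Y t z.2 - y t) - mu * ((N (Y t z.2) z.1)%:R - lambda * Y t z.2)))%:E)
  (g := fun w => (beta ^+ 2 * ((Y s w - y s) * (Y t w - y t)) + mu ^+ 2 * lambda * Y s w)%:E)).
- rewrite lin_mean unlock [in RHS]unlock integral_mfpp//.
  rewrite EFinD !EFinM fineK; last first.
    exact: (integrable_fin_num measurableT (sqr_integrableM (sc s) (sc t))).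
  by rewrite muleA.
- by apply/measurable_EFinP; apply: measurable_funM; exact: mb.
- exact: (sqr_integrableM (sqr_integrable_conditional_risk beta mu s0)
    (sqr_integrable_conditional_risk beta mu t0)).
- exact/measurable_EFinP.
- apply: filterS (inverse_process_homo_ae C12 HD st) => w2 Yst.
  have [B HB] := compensated_poisson_mul lambda_gt0 HN mu (beta * (Y s w2 - y s))
    (beta * (Y t w2 - y t)) (inverse_process_ge0 D s w2) Yst.
  split; first exact: (mean_bound_integrable HB).
  by have [_ _ ->] := HB; congr EFin; ring.
Qed.

Lemma mfpp_homo_ae s t : s <= t -> {ae P, forall w, (M s w <= M t w)%N}.
Proof.
move=> st; apply: filterS (inverse_process_homo_ae C12 HD st) => w Yst.
by have [_ _ _ mono _] := HN; apply: mono => //; exact: (inverse_process_ge0 D).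
Qed.

End mixed_process.

(** * Second level of randomness: the claims given the inverse process and the count *)

Section mixed_risk.
Context {d : measure_display} {T : measurableType d} {R : realType}.
Variables (P : probability T R) (alpha1 alpha2 C1 C2 lambda u rho mu : R).
Variables (D : R -> {RV P >-> R}) (N : R -> {RV P >-> nat}) (X : nat -> {RV P >-> R}).
Hypotheses (C12 : C1 + C2 = 1) (lambda_gt0 : 0 < lambda).
Hypothesis HD : mixed_stable_subordinator alpha1 alpha2 C1 C2 D.
Hypothesis HN : poisson_process lambda N.
Hypothesis HNY : independent_sigma P
  (process_sigma [set t : R | 0 <= t] (fun t => N t))
  (process_sigma [set t : R | 0 <= t] (inverse_process D)).
Hypotheses (X_indep : independent_family P (fun i => X i))
  (X_law : forall i, same_law P (X i) (X 0%N))
  (X_int : P.-integrable setT (EFin \o X 0%N))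
  (X_mean : 'E_P[X 0%N]%E = mu%:E)
  (X_mfpp : claims_independent_of_mfpp P D N X).

Local Notation Y := (inverse_process D).
Local Notation M := (mfpp D N).
Local Notation risk := (mixed_fractional_risk u mu rho lambda D N X).

(** Premium rate [mu * (1 + rho) * lambda] minus mean claim rate [mu * lambda]. *)
Let beta := mu * rho * lambda.
Let b := conditional_risk lambda D N beta mu.
Let xi i w := X i w - mu.
Let c := fine (\int[P]_w `|(X 0%N w - mu)%:E|)%E.

Let c_ge0 : 0 <= c.
Proof. by rewrite fine_ge0// integral_ge0. Qed.

Let xi_mean i : mean_bound P (xi i) 0 c.
Proof. exact: centered_mean_bound. Qed.

Let xi_uncorrelated i j : i != j -> mean_bound P (fun w => xi i w * xi j w) 0 (c * c).
Proof. exact: centered_uncorrelated. Qed.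

Let TX := process_space setT (fun i => X i).
Let TYM := process_space [set t : R | 0 <= t] (fun t w => (Y t w, M t w)).

Let mYM t : measurable_fun setT (fun w => (Y t w, M t w)).
Proof.
apply: measurable_fun_pair; first exact: (measurable_inverse_process HD t).
exact: (measurable_mfpp HD HN t).
Qed.

Let mTX : measurable_fun setT (id : T -> TX).
Proof. by apply: measurable_to_process_space => i _; exact: measurable_funPT. Qed.

Let mTYM : measurable_fun setT (id : T -> TYM).
Proof. by apply: measurable_to_process_space => t _; exact: mYM. Qed.

Let indep_X (A : set TX) (B : set TYM) : measurable A -> measurable B ->
  P ((id : T -> TX) @^-1` A `&` (id : T -> TYM) @^-1` B) =
  (P ((id : T -> TX) @^-1` A) * P ((id : T -> TYM) @^-1` B))%E.
Proof. exact: X_mfpp. Qed.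

Let mY t : 0 <= t -> measurable_fun setT (Y t : TYM -> R).
Proof.
move=> t0; apply: (measurableT_comp (f := fst) (g := fun w : TYM => (Y t w, M t w))) => //.
by have := measurable_from_process_space (times := [set t : R | 0 <= t])
  (Z := fun t w => (Y t w, M t w)) t0; apply.
Qed.

Let mM t : 0 <= t -> measurable_fun setT (M t : TYM -> nat).
Proof.
move=> t0; apply: (measurableT_comp (f := snd) (g := fun w : TYM => (Y t w, M t w))) => //.
by have := measurable_from_process_space (times := [set t : R | 0 <= t])
  (Z := fun t w => (Y t w, M t w)) t0; apply.
Qed.

Let mb t : 0 <= t -> measurable_fun setT (b t : TYM -> R).
Proof.
move=> t0; apply: measurable_funB.
  by apply: measurable_funM => //; apply: measurable_funB => //; exact: mY.
apply: measurable_funM => //; apply: measurable_funB.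
  by apply: measurable_natr; exact: mM.
by apply: measurable_funM => //; exact: mY.
Qed.

Let mxi i : measurable_fun setT (xi i : TX -> R).
Proof.
apply: measurable_funB => //.
by have := measurable_from_process_space (times := setT) (Z := fun i => X i)
  (i := i) Logic.I; apply.
Qed.

Let mb2 t : 0 <= t -> measurable_fun setT (fun z : TX * TYM => b t z.2).
Proof. by move=> t0; apply: (measurableT_comp (f := (b t : TYM -> R))) => //; exact: mb. Qed.

Let msum (F : nat -> TX -> R) t : 0 <= t -> (forall i, measurable_fun setT (F i)) ->
  measurable_fun setT (fun z : TX * TYM => \sum_(i < M t z.2) F i z.1).
Proof.
move=> t0 mF; apply: (measurable_nat_indexed
  (F := fun k (w : TX) => \sum_(i < k) F i w) (K := fun z : TX * TYM => M t z.2)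
  (phi := fst)) => //.
- by move=> k; apply: measurable_sum.
- by apply: (measurableT_comp (f := (M t : TYM -> nat))) => //; exact: mM.
Qed.

(** The centered risk with decoupled coordinates; the actual process is its value on the diagonal
    [(w, w)]. *)
Let A t (z : TX * TYM) : R := b t z.2 - \sum_(i < M t z.2) xi i z.1.

Let mA t : 0 <= t -> measurable_fun setT (A t).
Proof. by move=> t0; apply: measurable_funB; [exact: mb2|exact: msum]. Qed.

Let q t (z : TX * TYM) : R := \sum_(i < M t z.2) xi i z.1 ^+ 2.

Let mq t : 0 <= t -> measurable_fun setT (q t).
Proof. by move=> t0; apply: (msum (F := fun i w => xi i w ^+ 2) t0) => i; exact: measurable_funX. Qed.

Let sb t : 0 <= t -> sqr_integrable P (b t).
Proof. by move=> t0; exact: (sqr_integrable_conditional_risk C12 lambda_gt0 HD HN HNY). Qed.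

Let sbound t : 0 <= t -> sqr_integrable P (fun w => `|b t w| + (M t w)%:R * c).
Proof.
move=> t0; apply: sqr_integrableD; first exact: (sqr_integrable_norm (sb t0)).
under eq_fun do rewrite mulrC.
exact: (sqr_integrableZ c (sqr_integrable_mfpp C12 lambda_gt0 HD HN HNY t0)).
Qed.

(** Integrating the conditional bound [B] shows that [h] is integrable on the diagonal, which is
    what the Fubini form of decoupling asks for. *)
Let decouple_mean_bound (h : TX * TYM -> R) (m B : T -> R) :
  measurable_fun setT h -> measurable_fun setT m ->
  P.-integrable setT (EFin \o B) ->
  {ae P, forall w2 : T, mean_bound P (fun w1 : T => h (w1, w2)) (m w2) (B w2)} ->
  P.-integrable setT (fun w : T => (h (w, w))%:E) /\
  (\int[P]_w (h (w, w))%:E = \int[P]_w (m w)%:E)%E.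
Proof.
move=> mh mm iB hB.
have meh : measurable_fun setT (EFin \o h) by exact/measurable_EFinP.
have mabs : measurable_fun setT (fun z => `|(h z)%:E|)%E by exact: measurableT_comp.
have ih : P.-integrable setT (fun w : T => (h (w, w))%:E).
  apply/integrableP; split.
    apply: (measurableT_comp meh); exact: (measurable_fun_pair mTX mTYM).
  rewrite (decouple_ge0 mTX mTYM indep_X (h := fun z => `|(h z)%:E|%E))//.
  move/integrableP : (iB) => [mB]; apply: le_lt_trans.
  apply: ae_ge0_le_integral => //.
  - by move=> w2 _; apply: integral_ge0.
  - exact: (measurable_decoupled_ge0 P mTX mTYM (h := fun z => `|(h z)%:E|%E)).
  - exact: measurableT_comp.
  - apply: filterS hB => w2 [_ hB _] _; apply: (le_trans hB).
    by rewrite /= lee_fin ler_norm.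
split=> //.
rewrite (decouple_integrable mTX mTYM indep_X (h := EFin \o h)
  (g := fun w => (m w)%:E))//; first exact/measurable_EFinP.
by apply: filterS hB => w2 hw2; split; [exact: (mean_bound_integrable hw2)|case: hw2].
Qed.

Let riskE t w : risk t w = u + beta * fine (\int[P]_w (Y t w)%:E)%E + A t (w, w).
Proof.
rewrite /mixed_fractional_risk /A /b /conditional_risk /xi /= sumrB sumr_const card_ord.
by rewrite -[mu *+ _]mulr_natr /beta; ring.
Qed.

Let risk_mean t : 0 <= t ->
  ('E_P[risk t] = (u + beta * fine (\int[P]_w (Y t w)%:E)%E)%:E)%E.
Proof.
move=> t0; set k := u + _.
have [iA EA] := decouple_mean_bound (mA t0) (sb t0).1
  (sqr_integrable_integrable (sbound t0))
  (aeW _ (fun w2 => mean_bound_sub_sum xi_mean (b t w2) (M t w2))).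
rewrite unlock (eq_integral (fun w : T => k%:E + (A t (w, w))%:E)%E).
  rewrite integralD//; last exact: (mean_bound_integrable (mean_bound_cst P k)).
  rewrite EA (integral_conditional_risk C12 lambda_gt0 HD HN HNY)// adde0.
  by have /= -> := integral_cst P measurableT k%:E; rewrite probability_setT mule1.
by move=> w _; rewrite riskE EFinD.
Qed.

(** The product of centered risks is split into [A s * A t - q s], integrable with conditional mean
    [b s * b t], and the nonnegative [q s]. The contributions [mu^2] and variance of a claim, both
    times the mean count, add up to the second moment. *)
Lemma risk_covariance s t : 0 <= s -> s <= t ->
  (covariance P (risk s) (risk t) =
    (mu ^+ 2 * lambda ^+ 2 * rho ^+ 2)%:E * covariance P (Y s) (Y t) +
    'E_P[fun w => (X 0%N w ^+ 2)%R] * 'E_P[fun w => (M s w)%:R])%E.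
Proof.
move=> s0 st; have t0 : 0 <= t by rewrite (le_trans s0).
have mg : measurable_fun setT (fun z => A s z * A t z - q s z).
  by apply: measurable_funB; [apply: measurable_funM; exact: mA|exact: mq].
have mbb : measurable_fun setT (fun w => b s w * b t w).
  by apply: measurable_funM; [have [] := sb s0|have [] := sb t0].
have [ig Eg] := decouple_mean_bound mg mbb (sqr_integrableM (sbound s0) (sbound t0))
  (filterS (fun w2 => mean_bound_mul_sub_sum xi_mean xi_uncorrelated (b s w2) (b t w2) c_ge0)
    (mfpp_homo_ae C12 HD HN st)).
have Eq : (\int[P]_w (q s (w, w))%:E =
    \int[P]_w ((X 0%N w - mu) ^+ 2)%:E * \int[P]_w (M s w)%:R%:E)%E.
  rewrite (decouple_ge0 mTX mTYM indep_X (h := EFin \o q s)); last 2 first.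
  - by apply/measurable_EFinP; exact: mq.
  - by move=> z; rewrite lee_fin sumr_ge0// => i _; exact: sqr_ge0.
  rewrite -ge0_integralZl//; last 2 first.
  - by apply/measurable_EFinP/measurable_natr; exact: (measurable_mfpp HD HN s).
  - by apply: integral_ge0 => w _; rewrite lee_fin sqr_ge0.
  apply: eq_integral => w2 _; rewrite /q /=.
  under eq_integral do rewrite -sumEFin.
  have mxi2 i : measurable_fun setT (fun w => (xi i w ^+ 2)%:E).
    by apply/measurable_EFinP/measurable_funX; have [] := xi_mean i.
  rewrite ge0_integral_sum//; last by move=> i w _; rewrite lee_fin sqr_ge0.
  rewrite (eq_bigr (fun=> \int[P]_w ((X 0%N w - mu) ^+ 2)%:E)%E); last first.
    move=> i _; apply: (same_law_ge0_integral (X_law i) (f := fun x => ((x - mu) ^+ 2)%:E)).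
      by apply/measurable_EFinP; apply: measurable_funX; exact: measurable_funB.
    by move=> x; rewrite lee_fin sqr_ge0.
  (* A sum of [m] equal terms, taken in the extended reals because the variance may be infinite. *)
  elim: (M s w2) => [|m IH]; first by rewrite big_ord0 mule0.
  by rewrite big_ord_recr/= IH -natr1 EFinD ge0_muleDr ?mule1// lee_fin.
have v0 : (0 <= \int[P]_w ((X 0%N w - mu) ^+ 2)%:E)%E.
  by apply: integral_ge0 => w _; rewrite lee_fin sqr_ge0.
have covE : covariance P (risk s) (risk t) =
    (\int[P]_w (A s (w, w) * A t (w, w) - q s (w, w) + q s (w, w))%:E)%E.
  rewrite unlock !risk_mean//= unlock; apply: eq_integral => w _.
  have AE r : A r (w, w) = risk r w - (u + beta * fine (\int[P]_w (Y r w)%:E)%E).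
    by rewrite riskE addrAC subrr add0r.
  by rewrite subrK !AE.
rewrite covE integralD_ge0r//; last 2 first.
- by apply: (measurableT_comp (mq s0)); exact: (measurable_fun_pair mTX mTYM).
- by move=> w; apply: sumr_ge0 => i _; exact: sqr_ge0.
rewrite Eg Eq (integral_conditional_risk_mul C12 lambda_gt0 HD HN HNY)//.
have expE (f : T -> R) : ('E_P[f] = \int[P]_w (f w)%:E)%E by rewrite unlock.
have mu2 : (0 <= (mu ^+ 2)%:E)%E by rewrite lee_fin sqr_ge0.
rewrite !expE (second_moment_centered X_int X_mean) (ge0_muleDl _ v0 mu2).
rewrite -addeA; congr (_ * _ + _)%E; last by rewrite addeC.
by congr EFin; rewrite /beta; ring.
Qed.

End mixed_risk.

Theorem proposition4p1 (d : measure_display) (T : measurableType d)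
  (R : realType) (P : probability T R)
  (alpha1 alpha2 C1 C2 lambda u rho mu : R)
  (alpha2_gt0 : 0 < alpha2) (alpha21 : alpha2 < alpha1) (alpha1_lt1 : alpha1 < 1)
  (C1_ge0 : 0 <= C1) (C2_ge0 : 0 <= C2) (C12 : C1 + C2 = 1)
  (u_gt0 : 0 < u) (rho_ge0 : 0 <= rho) (lambda_gt0 : 0 < lambda)
  (mu_gt0 : 0 < mu)
  (D : R -> {RV P >-> R}) (N : R -> {RV P >-> nat}) (X : nat -> {RV P >-> R})
  (HD : mixed_stable_subordinator alpha1 alpha2 C1 C2 D)
  (HN : poisson_process lambda N)
  (HNY : independent_sigma P
           (process_sigma [set t : R | 0 <= t] (fun t => N t))
           (process_sigma [set t : R | 0 <= t] (inverse_process D)))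
  (X_indep : independent_family P (fun i => X i))
  (X_law : forall i, same_law P (X i) (X 0%N))
  (X_int : P.-integrable setT (EFin \o X 0%N))
  (X_mean : 'E_P[X 0%N]%E = mu%:E)
  (X_mfpp : claims_independent_of_mfpp P D N X) :
  let Y := inverse_process D in
  let M := fun (t : R) (w : T) => (mfpp D N t w)%:R : R in
  let risk := mixed_fractional_risk u mu rho lambda D N X in
  let EX2 := 'E_P[fun w => (X 0%N w ^+ 2)%R]%E in
  (forall s t : R, 0 <= s -> s <= t ->
     covariance P (risk s) (risk t)
     = ((mu ^+ 2 * lambda ^+ 2 * rho ^+ 2)%:E * covariance P (Y s) (Y t)
        + EX2 * 'E_P[M s])%E) /\
  (forall t : R, 0 <= t ->
     'V_P[risk t]%E
     = ((mu ^+ 2 * lambda ^+ 2 * rho ^+ 2)%:E * 'V_P[Y t]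
        + EX2 * 'E_P[M t])%E).
Proof.
have cov s t s0 st := risk_covariance u rho C12 lambda_gt0 HD HN HNY X_indep X_law
  X_int X_mean X_mfpp (s := s) (t := t) s0 st.
(* The variance is the covariance at [s = t]. *)
by split=> [s t|t t0]; [exact: cov|exact: cov].
Qed.
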